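(* Let $n\ge1$. A vector $\mathbf d\in\mathbb Z^n$ is contained in the (relative) boundary of $\mathcal D_n$ if and only if it is the net-degree sequence of a weakly split digraph on the node set $[n]$.
   Context: $[n]=\{1,\dots,n\}$. A (simple) digraph $D=(V,A)$ is a finite simple undirected graph together with an orientation of each edge; so $A\subseteq V\times V$ contains no $(v,v)$, and at most one of $(u,v),(v,u)$. Its net-degree sequence is $\mathbf d(D)\in\mathbb Z^V$ with $\mathbf d(D)_v=|\{u:(u,v)\in A\}|-|\{u:(v,u)\in A\}|$. A simple digraph $D=(V,A)$ is weakly split if there is a partition $V=V_s\uplus V_t$ into two nonempty sets such that $V_s\times V_t\subseteq A$. With $e_1,\dots,e_n$ the standard basis of $\mathbb R^n$, $\mathcal D_n:=\sum_{1\le i<j\le n}[e_i-e_j,\,e_j-e_i]\subset\mathbb R^n$ (Minkowski sum of line segments). It is full-dimensional in the hyperplane $\{x\in\mathbb R^n: x_1+\cdots+x_n=0\}$, and its boundary is taken relative to this hyperplane. *)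

(* Defs.v *)
From mathcomp Require Import all_boot all_order all_algebra.

Set Implicit Arguments.
Unset Strict Implicit.
Unset Printing Implicit Defensive.

Import Order.TTheory GRing.Theory Num.Theory.

Local Open Scope ring_scope.

(* The two axioms make [arcs] an orientation of a simple undirected graph;
   two nodes may be joined by no arc at all. *)
Record digraph (V : finType) := Digraph {
  arcs : {set V * V};
  arcs_loopless : forall v, (v, v) \notin arcs;
  arcs_oriented : forall u v, ~~ (((u, v) \in arcs) && ((v, u) \in arcs))
}.

(* In-degree minus out-degree. *)
Definition net_degree (V : finType) (D : digraph V) (v : V) : int :=
  #|[set u | (u, v) \in arcs D]|%:Z - #|[set u | (v, u) \in arcs D]|%:Z.

Definition net_degree_sequence (n : nat) (D : digraph 'I_n) : 'rV[int]_n :=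
  \row_i net_degree D i.

Definition weakly_split (V : finType) (D : digraph V) : Prop :=
  exists Vs Vt : {set V},
    [/\ Vs :|: Vt = [set: V], [disjoint Vs & Vt],
        Vs != set0, Vt != set0 &
        setX Vs Vt \subset arcs D].

From mathcomp Require Import all_classical all_reals all_analysis.
Import numFieldNormedType.Exports.
Local Open Scope classical_set_scope.

Definition segment (R : realType) (E : lmodType R) (a b : E) : set E :=
  [set (1 - t) *: a + t *: b | t in `[0, 1]].

Definition minkowski_sum (E : nmodType) (I : finType) (P : pred I)
    (S : I -> set E) : set E :=
  [set \sum_(i | P i) y i | y in [set y : I -> E | forall i, P i -> S i (y i)]].

Definition std_basis (R : realType) (n : nat) (i : 'I_n) : 'rV[R]_n :=
  delta_mx 0 i.
Arguments std_basis R {n} i.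

Definition polytope_D (R : realType) (n : nat) : set 'rV[R]_n :=
  minkowski_sum (fun ij : 'I_n * 'I_n => (ij.1 < ij.2)%N)
    (fun ij => segment (std_basis R ij.1 - std_basis R ij.2)
                       (std_basis R ij.2 - std_basis R ij.1)).
Arguments polytope_D : clear implicits.

Definition sum_zero_hyperplane (R : realType) (n : nat) : set 'rV[R]_n :=
  [set x | \sum_i x 0 i = 0].
Arguments sum_zero_hyperplane : clear implicits.

(* The topology of [subspace H] is discrete outside [H], so for [B `<=` H] this
   is the boundary of [B] in the subspace topology on [H]. *)
Definition relative_boundary (T : topologicalType) (H B : set T) : set T :=
  closure (B : set (subspace H)) `\` interior (B : set (subspace H)).

(* Main.v *)
(** A point of [D_n] is a vector of net flows [x v = \sum_e s e * (v == e.1) -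
    s e * (v == e.2)] with [|s e| <= 1] on the edges of the complete graph; when
    [s] is integral it is the same thing as a digraph.  By submodularity of the
    cut function, such an [s] exists, over any ordered ring, if and only if the
    coordinates of [x] sum to [0] and [x(S) <= cut(S)] for all [S].  These are
    therefore the facet inequalities of [D_n], its boundary consists of the
    points where one of them is tight for a proper nonempty [S], and integral
    points are realised by digraphs.  Finally [d(S) = cut(S)] for the net
    degrees of a digraph says that all arcs from the complement of [S] to [S]
    are present. *)

Require Import Defs.
From mathcomp Require Import all_boot all_order all_algebra.
From mathcomp Require Import lra.
From mathcomp Require Import all_classical all_reals all_analysis.
Import Order.TTheory GRing.Theory Num.Theory.
Import numFieldNormedType.Exports.
Local Open Scope classical_set_scope.
Local Open Scope ring_scope.

(** * Cuts, incidence sums and flows with prescribed net values *)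

Definition crosses {V : finType} (S : {set V}) (e : V * V) : bool :=
  (e.1 \in S) != (e.2 \in S).

Definition incidence {R : pzRingType} {V : finType} (v : V) (e : V * V) : R :=
  (v == e.1)%:R - (v == e.2)%:R.

Lemma sum_incidence (R : pzRingType) (V : finType) (S : {set V}) (e : V * V) :
  \sum_(v in S) incidence v e = (e.1 \in S)%:R - (e.2 \in S)%:R :> R.
Proof.
have indic (a : V) : \sum_(v in S) (v == a)%:R = (a \in S)%:R :> R.
  rewrite big_mkcond (bigD1 a) //= eqxx big1 ?addr0; first by case: ifP.
  by move=> i /negbTE ->; case: ifP.
by rewrite sumrB !indic.
Qed.

Lemma crosses_submodular (V : finType) (S T : {set V}) (e : V * V) :
  (crosses (S :&: T) e + crosses (S :|: T) e <= crosses S e + crosses T e)%N.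
Proof.
rewrite /crosses !inE.
by case: (e.1 \in S); case: (e.1 \in T); case: (e.2 \in S); case: (e.2 \in T).
Qed.

Lemma sum_setI_setU (R : pzRingType) (V : finType) (x : V -> R)
    (S T : {set V}) :
  \sum_(v in S) x v + \sum_(v in T) x v =
  \sum_(v in S :&: T) x v + \sum_(v in S :|: T) x v.
Proof.
rewrite !(big_mkcond (fun v => v \in _)) -!big_split; apply: eq_bigr => v _.
by rewrite !inE; case: (v \in S); case: (v \in T); rewrite /= ?addr0 ?add0r.
Qed.

(* A Hoffman-type circulation theorem.  Edges are peeled off one by one: the
   values of [s] on the peeled edge that keep all cut conditions form an
   interval, nonempty because the cut function is submodular.  Its lower
   endpoint is a maximum of integer combinations of the data, so the same
   argument serves over [int] and over the reals. *)
Lemma cut_condition_flow (R : realDomainType) (V : finType) (E : seq (V * V))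
    (x : V -> R) :
  uniq E -> \sum_v x v = 0 ->
  (forall S : {set V},
     \sum_(v in S) x v <= \sum_(e <- E) (crosses S e)%:R) ->
  exists s : V * V -> R, (forall e, -1 <= s e <= 1) /\
    forall v, x v = \sum_(e <- E) s e * incidence v e.
Proof.
elim: E x => [|[i j] E IH] x.
  move=> _ x0 xS; exists (fun=> 0); split=> [e|v].
    by rewrite oppr_le0 ler01.
  (* Without edges, the conditions for {v} and its complement bound [x v] by 0 from above and from
     below. *)
  rewrite big_nil; have := xS [set v]%SET; have := xS [set~ v]%SET.
  rewrite !big_nil big_set1; move: x0; rewrite (bigD1 v) //=.
  under [X in _ -> X <= 0 -> _]eq_bigl do rewrite !inE.
  by move=> /eqP; rewrite addr_eq0 => /eqP -> ?; rewrite oppr_le0 => ?; lra.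
move=> /= /andP[ijE uE] x0 xS.
pose X (S : {set V}) := \sum_(v in S) x v.
pose C (S : {set V}) : R := \sum_(e <- E) (crosses S e)%:R.
have xS' S : X S <= (crosses S (i, j))%:R + C S.
  by move: (xS S); rewrite big_cons.
have CIU S T : C (S :&: T) + C (S :|: T) <= C S + C T.
  rewrite -!big_split; apply: ler_sum => e _ /=.
  by rewrite -!natrD ler_nat crosses_submodular.
have XIU S T : X S + X T = X (S :&: T) + X (S :|: T) by exact: sum_setI_setU.
(* The least value on [(i, j)] that keeps the conditions for all sets containing [i] but not [j];
   the default -1 enforces the lower bound. *)
pose c := \big[Num.max/-1]_(S : {set V} | (i \in S) && (j \notin S))
  (X S - C S).
have c_lo (S : {set V}) : i \in S -> j \notin S -> X S - c <= C S.
  move=> iS jS; rewrite lerBlDl -lerBlDr.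
  by apply: (le_bigmax_cond _ (fun S => X S - C S)); rewrite iS.
have c_ge : -1 <= c by apply: bigmax_ge_id.
have c_le : c <= 1.
  apply/bigmax_leP; split=> [|S /andP[iS /negbTE jS]]; first by lra.
  by have := xS' S; rewrite /crosses /= iS jS /=; lra.
have c_hi (T : {set V}) : i \notin T -> j \in T -> X T + c <= C T.
  move=> /negbTE iT jT; rewrite -lerBrDl.
  apply/bigmax_leP; split=> [|S /andP[iS /negbTE jS]].
    by have := xS' T; rewrite /crosses /= iT jT /=; lra.
  (* Uncrossing: [S :&: T] contains neither end and [S :|: T] both, so [(i, j)] crosses neither set,
     and submodularity gives X(S) - C(S) <= C(T) - X(T). *)
  have := xS' (S :&: T); have := xS' (S :|: T).
  rewrite /crosses /= !inE iS jS iT jT /=.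
  by have := CIU S T; have := XIU S T; lra.
have [|S|s [s1 sE]] := IH (fun v => x v - c * incidence v (i, j)) uE.
- rewrite sumrB x0 -mulr_sumr.
  have := sum_incidence R _ [set: V]%SET (i, j); rewrite !inE subrr.
  by under eq_bigl do rewrite inE; move=> ->; rewrite mulr0 subr0.
- rewrite sumrB -mulr_sumr sum_incidence /= -/(X S) -/(C S).
  case iS: (i \in S); case jS: (j \in S) => /=.
  + by have := xS' S; rewrite /crosses /= iS jS /=; lra.
  + by have := c_lo S; rewrite iS jS => /(_ isT isT); lra.
  + by have := c_hi S; rewrite iS jS => /(_ isT isT); lra.
  + by have := xS' S; rewrite /crosses /= iS jS /=; lra.
exists (fun e => if e == (i, j) then c else s e); split=> [e|v].
  by case: ifP => _; [rewrite c_ge c_le|exact: s1].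
(* Since [(i, j)] does not recur in [E], giving it the value [c] leaves the rest of the flow
   unchanged. *)
rewrite big_cons eqxx; under eq_big_seq => e eE.
  by case: eqP => [eij|_]; [move: eE ijE; rewrite eij => ->|over].
by rewrite -sE; lra.
Qed.

Lemma sum_flow (R : comPzRingType) (V : finType) (P : pred (V * V))
    (s : V * V -> R) (S : {set V}) :
  \sum_(v in S) \sum_(e | P e) s e * incidence v e =
  \sum_(e | P e) s e * ((e.1 \in S)%:R - (e.2 \in S)%:R).
Proof.
rewrite exchange_big; apply: eq_bigr => e _.
by rewrite -mulr_sumr sum_incidence.
Qed.

Lemma flow_le_crosses (R : realDomainType) (V : finType) (S : {set V})
    (e : V * V) (t : R) :
  -1 <= t <= 1 ->
  t * ((e.1 \in S)%:R - (e.2 \in S)%:R) <= (crosses S e)%:R.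
Proof.
rewrite /crosses => /andP[]; case: (e.1 \in S); case: (e.2 \in S) => /=; lra.
Qed.

(** * Flows on the complete graph and the cut inequalities *)

Definition edge {n : nat} : pred ('I_n * 'I_n) := fun e => (e.1 < e.2)%N.

(** Equal to |S|(n - |S|), as each pair of distinct nodes occurs once in [edge]. *)
Definition cut {n : nat} (S : {set 'I_n}) : nat :=
  (\sum_(e : 'I_n * 'I_n | edge e) crosses S e)%N.

(** Summing over S cancels the edges that do not cross S and leaves at most 1 for each that does;
    the converse is [cut_condition_flow] for the list of all edges. *)
Lemma flow_cutP (R : realDomainType) (n : nat) (x : 'I_n -> R) :
  (exists s : 'I_n * 'I_n -> R, (forall e, -1 <= s e <= 1) /\
     forall v, x v = \sum_(e | edge e) s e * incidence v e) <->
  \sum_v x v = 0 /\ forall S : {set 'I_n}, \sum_(v in S) x v <= (cut S)%:R.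
Proof.
split=> [[s [s1 xE]]|[x0 xS]].
  have sumx (S : {set 'I_n}) : \sum_(v in S) x v =
      \sum_(e | edge e) s e * ((e.1 \in S)%:R - (e.2 \in S)%:R).
    by rewrite -sum_flow; apply: eq_bigr => v _; exact: xE.
  split=> [|S].
    have := sumx [set: 'I_n]%SET.
    under eq_bigl do rewrite inE.
    by move=> ->; apply: big1 => e _; rewrite !inE subrr mulr0.
  rewrite sumx natr_sum; apply: ler_sum => e _.
  exact: flow_le_crosses.
have enumE (F : 'I_n * 'I_n -> R) :
  \sum_(e <- enum edge) F e = \sum_(e | edge e) F e by rewrite big_enum.
have [S|s [s1 xE]] := @cut_condition_flow R _ (enum edge) x (enum_uniq _) x0.
  by rewrite enumE -natr_sum; exact: xS.
by exists s; split=> // v; rewrite xE enumE.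
Qed.

(** * Digraphs as integral flows *)

Definition flow_of {n : nat} (D : digraph 'I_n) (e : 'I_n * 'I_n) : int :=
  ((e.2, e.1) \in arcs D)%:R - (e \in arcs D)%:R.

Lemma flow_of_bounds {n : nat} (D : digraph 'I_n) e : -1 <= flow_of D e <= 1.
Proof. by rewrite /flow_of; case: (_ \in _); case: (_ \in _). Qed.

Lemma net_degree_flow {n : nat} (D : digraph 'I_n) (v : 'I_n) :
  net_degree D v = \sum_(e | edge e) flow_of D e * incidence v e.
Proof.
have card_arcs (P : pred 'I_n) : #|[set u | P u]%SET|%:Z = \sum_u (P u)%:R.
  rewrite -natz -sum1_card natr_sum big_mkcond /=; apply: eq_bigr => u _.
  by rewrite inE; case: (P u).
have swapE (F : 'I_n * 'I_n -> int) :
    \sum_(e | edge e) F e = \sum_(e | edge (e.2, e.1)) F (e.2, e.1).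
  rewrite (reindex_inj (h := fun e : 'I_n * 'I_n => (e.2, e.1))) //.
  by move=> -[? ?] [? ?] [-> ->].
(* All ordered pairs starting at [v] are summed first; antisymmetry of [flow_of] folds the
   descending pairs onto the edges, and the diagonal vanishes. *)
transitivity (\sum_e flow_of D e * (v == e.1)%:R).
  have -> : \sum_e flow_of D e * (v == e.1)%:R =
      \sum_a \sum_b flow_of D (a, b) * (v == a)%:R.
    by rewrite pair_bigA; apply: eq_bigr => -[].
  rewrite /net_degree !card_arcs -sumrB.
  rewrite [RHS](bigD1 v) //= [X in _ = _ + X]big1 ?addr0.
    by apply: eq_bigr => u _; rewrite eqxx mulr1.
  by move=> i iv; apply: big1 => j _; rewrite eq_sym (negbTE iv) mulr0.
under [RHS]eq_bigr do rewrite mulrBr.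
rewrite sumrB [X in _ = _ - X]swapE -sumrN (bigID edge) /=; congr (_ + _).
rewrite [LHS]big_mkcond [RHS]big_mkcond; apply: eq_bigr => -[a b] _ /=.
rewrite /edge /flow_of /=; case: ltngtP => //= [_|/val_inj->].
  by rewrite -mulNr opprB.
by rewrite subrr mul0r.
Qed.

(** Value 1 becomes the arc from [e.2] to [e.1], since it must raise the net degree of [e.1]; value
    -1 becomes the arc [e], and 0 no arc. *)
Lemma int_flow_digraph {n : nat} (s : 'I_n * 'I_n -> int) :
  (forall e, -1 <= s e <= 1) ->
  exists D : digraph 'I_n, forall e, edge e -> flow_of D e = s e.
Proof.
move=> s1; pose A : {set 'I_n * 'I_n} :=
  [set e | edge e && (s e == -1) || edge (e.2, e.1) && (s (e.2, e.1) == 1)]%SET.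
have loopless v : (v, v) \notin A by rewrite inE /edge /= ltnn.
have oriented u v : ~~ (((u, v) \in A) && ((v, u) \in A)).
  rewrite !inE /edge /=; case: ltngtP => //= _; rewrite ?orbF.
    by case: eqP => // ->.
  by case: eqP => // ->.
exists (Digraph loopless oriented) => -[u v] euv.
rewrite /flow_of !inE; move: euv; rewrite /edge /= => uv.
rewrite uv ltnNge ltnW //= orbF; have := s1 (u, v).
by case: (s (u, v)) => [[|[|]]|[|]].
Qed.

(* The flow along every edge crossing [(Vs, Vt)] attains its bound exactly when
   every arc from [Vs] to [Vt] is present. *)
Lemma weakly_splitP {n : nat} (D : digraph 'I_n) :
  weakly_split D <-> exists S : {set 'I_n},
    [/\ S != finset.set0, ~: S != finset.set0 &
        \sum_(v in S) net_degree D v = (cut S)%:R]%SET.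
Proof.
have sumE (S : {set 'I_n}) : \sum_(v in S) net_degree D v =
    \sum_(e | edge e) flow_of D e * ((e.1 \in S)%:R - (e.2 \in S)%:R).
  by under eq_bigr do rewrite net_degree_flow; rewrite sum_flow.
split=> [[Vs [Vt [VsUt Vst Vs0 Vt0 splitD]]]|[S [S0 S1 tight]]].
  have VsC : (Vs = ~: Vt)%SET.
    apply/setP => v; rewrite inE.
    have : (v \in Vs :|: Vt)%SET by rewrite VsUt inE.
    rewrite inE; case vs: (v \in Vs); case vt: (v \in Vt) => //= _.
    by have := disjointFr Vst vs; rewrite vt.
  have arcD u v : u \notin Vt -> v \in Vt ->
      ((u, v) \in arcs D) && ((v, u) \notin arcs D).
    move=> ut vt; have uv : (u, v) \in arcs D.
      by apply: (fintype.subsetP splitD (u, v)); rewrite !inE VsC inE ut.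
    by have := arcs_oriented D u v; rewrite uv.
  exists Vt; split; rewrite -?VsC // sumE natr_sum; apply: eq_bigr => -[u v] _.
  rewrite /crosses /flow_of /=.
  case ut: (u \in Vt); case vt: (v \in Vt) => //=; rewrite ?subrr ?mulr0 //.
    by have /andP[-> /negbTE->] := arcD v u (negbT vt) ut.
  by have /andP[-> /negbTE->] := arcD u v (negbT ut) vt.
(* The slacks of the edges are nonnegative and sum to zero, so each of them is zero. *)
have tightE e : edge e -> (crosses S e)%:R =
    flow_of D e * ((e.1 \in S)%:R - (e.2 \in S)%:R).
  move=> eE; apply/eqP; rewrite -subr_eq0; apply/eqP.
  apply: (psumr_eq0P (P := edge) (F := fun e => (crosses S e)%:R -
     flow_of D e * ((e.1 \in S)%:R - (e.2 \in S)%:R))) => // [f _|].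
    by rewrite subr_ge0 flow_le_crosses ?flow_of_bounds.
  by rewrite sumrB -sumE tight natr_sum subrr.
(* Incoming arcs count positively, so the tight set is the target side. *)
exists (~: S)%SET, S; split=> //.
- by rewrite finset.setUC finset.setUCr.
- by rewrite -finset.setI_eq0 finset.setIC finset.setICr.
apply/fintype.subsetP => -[u v]; rewrite !inE /= => /andP[uS vS].
have : u != v by apply: contraNneq uS => ->.
rewrite neq_ltn => /orP[uv|vu].
  have := tightE (u, v) uv; rewrite /crosses /flow_of /= (negbTE uS) vS /=.
  by case: (_ \in _); case: (_ \in _).
have := tightE (v, u) vu; rewrite /crosses /flow_of /= (negbTE uS) vS /=.
by case: (_ \in _); case: (_ \in _).
Qed.

(** * The polytope and its relative boundary *)

Lemma polytope_D_flow (R : realType) (n : nat) (x : 'rV[R]_n) :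
  polytope_D R n x <-> exists s : 'I_n * 'I_n -> R,
    (forall e, -1 <= s e <= 1) /\
    forall v, x 0 v = \sum_(e | edge e) s e * incidence v e.
Proof.
pose u (e : 'I_n * 'I_n) : 'rV[R]_n := std_basis R e.1 - std_basis R e.2.
have uE e v : u e 0 v = incidence v e.
  by rewrite !mxE !eqxx.
(* The change of parameter s = 1 - 2t carries [0, 1] onto [-1, 1]. *)
have segE (e : 'I_n * 'I_n) (t : R) :
    (1 - t) *: (std_basis R e.1 - std_basis R e.2) +
      t *: (std_basis R e.2 - std_basis R e.1) = (1 - 2 * t) *: u e.
  by apply/rowP => v; rewrite !mxE; lra.
split=> [[y yP <-]|[s [s1 xE]]].
  have segP e : edge e -> exists s : R, -1 <= s <= 1 /\ y e = s *: u e.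
    move=> /yP[t]; rewrite /= in_itv /= => /andP[t0 t1] <-.
    by exists (1 - 2 * t); split; [lra|rewrite segE].
  (* [choice] asks for a value at every pair; those outside [edge] get 0. *)
  have {}segP e : exists s : R, -1 <= s <= 1 /\ (edge e -> y e = s *: u e).
    case eE: (edge e); last by exists 0; rewrite oppr_le0 ler01.
    by have [s [s1 ys]] := segP e eE; exists s.
  have [s sP] := choice segP; exists s; split=> [e|v]; first by case: (sP e).
  rewrite summxE; apply: eq_bigr => e eE.
  by rewrite (proj2 (sP e) eE) mxE uE.
exists (fun e => s e *: u e).
  move=> e _ /=; exists ((1 - s e) / 2).
    by rewrite /= in_itv /=; have := s1 e; lra.
  by rewrite segE; congr (_ *: _); lra.
by apply/rowP => v; rewrite summxE xE; apply: eq_bigr => e _; rewrite mxE uE.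
Qed.

Lemma polytope_D_cut (R : realType) (n : nat) (x : 'rV[R]_n) :
  polytope_D R n x <-> \sum_v x 0 v = 0 /\
    forall S : {set 'I_n}, \sum_(v in S) x 0 v <= (cut S)%:R.
Proof. by rewrite polytope_D_flow (flow_cutP _ _ (fun v => x 0 v)). Qed.

Lemma sum_coord_continuous (R : realType) (n : nat) (P : pred 'I_n) :
  continuous (fun x : 'rV[R]_n => \sum_(v | P v) x 0 v).
Proof.
move=> x; apply: (@cvg_big _ _ _ _ _ _ _ (nbhs x)) => [|v _].
  exact: add_continuous.
exact: coord_continuous.
Qed.

Lemma polytope_D_closed (R : realType) (n : nat) : closed (polytope_D R n).
Proof.
have -> : polytope_D R n =
    (fun x : 'rV[R]_n => \sum_v x 0 v) @^-1` [set 0] `&`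
    \bigcap_(S in [set: {set 'I_n}])
      (fun x : 'rV[R]_n => \sum_(v in S) x 0 v) @^-1` [set t | t <= (cut S)%:R].
  apply/seteqP; split=> x.
    by move=> /polytope_D_cut[x0 xS]; split=> // S _; exact: xS.
  by move=> [x0 xS]; apply/polytope_D_cut; split=> // S; exact: (xS S).
apply: closedI.
  apply: closed_comp; last exact: closed_eq.
  by move=> x _; exact: sum_coord_continuous.
apply: closed_bigI => S _.
apply: closed_comp; last exact: closed_le.
by move=> x _; exact: sum_coord_continuous.
Qed.

Lemma relative_boundary_polytope_D (R : realType) (n : nat) (x : 'rV[R]_n) :
  relative_boundary (sum_zero_hyperplane R n) (polytope_D R n) x <->
  polytope_D R n x /\ exists S : {set 'I_n},
    [/\ S != finset.set0, ~: S != finset.set0 &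
        \sum_(v in S) x 0 v = (cut S)%:R]%SET.
Proof.
set H := sum_zero_hyperplane R n; set P := polytope_D R n.
have PH : P `<=` H by move=> y /polytope_D_cut[].
have clP : closure (P : set (subspace H)) = P.
  by apply/esym/closure_id; apply: closed_subspaceW; exact: polytope_D_closed.
have intP : P x -> interior (P : set (subspace H)) x =
    (\forall y \near x, H y -> P y).
  by move=> /PH Hx; rewrite /interior /= /nbhs /= -nbhs_subspace_in.
rewrite /relative_boundary clP; split=> [[Px nintP]|[Px [S [S0 S1 tight]]]].
  split=> //; apply: contrapT => notight; apply: nintP; rewrite intP //.
  have [x0 xS] := (polytope_D_cut _ _ _).1 Px.
  (* For the empty and the full set the inequality holds on all of [H]; the others are strict at [x]
     and persist nearby. There are finitely many [S], so one neighbourhood serves all. *)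
  have slack (S : {set 'I_n}) : \forall y \near x,
      H y -> \sum_(v in S) y 0 v <= (cut S)%:R.
    have [->|S0] := eqVneq S finset.set0.
      by apply: (@filterE _ (nbhs x)) => y _; rewrite big_set0.
    have [SC0|S1] := eqVneq (~: S)%SET finset.set0.
      apply: (@filterE _ (nbhs x)) => y Hy.
      have -> : \sum_(v in S) y 0 v = \sum_v y 0 v.
        apply: eq_bigl => v; apply/negbNE.
        by rewrite -finset.in_setC SC0 finset.in_set0.
      by rewrite Hy.
    have : \sum_(v in S) x 0 v < (cut S)%:R.
      rewrite lt_neqAle xS andbT; apply/eqP => tight; apply: notight.
      by exists S.
    move=> /(cvgr_lt _ (sum_coord_continuous _ _ _ x)) near_lt.
    by apply: (@filterS _ (nbhs x) _ _ _ _ near_lt) => y /ltW.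
  have near_le := @filter_forall _ _ _ (nbhs x) (nbhs_filter x) slack.
  apply: (@filterS _ (nbhs x) _ _ _ _ near_le) => y yS Hy.
  by apply/polytope_D_cut; split=> // S; exact: yS.
split=> //; rewrite intP // => nearP.
have /set0Pn[a aS] := S0; have /set0Pn[b] := S1; rewrite inE => bS.
(* Moving along [w] stays in [H] and raises the sum over [S] at unit rate, so any t > 0 violates the
   tight inequality. *)
pose w : 'rV[R]_n := std_basis R a - std_basis R b.
have wE v : w 0 v = incidence v (a, b) by rewrite !mxE !eqxx.
have sumw (t : R) (Q : {set 'I_n}) : \sum_(v in Q) (x + t *: w) 0 v =
    \sum_(v in Q) x 0 v + t * ((a \in Q)%:R - (b \in Q)%:R).
  rewrite -(sum_incidence _ _ Q (a, b)) mulr_sumr -big_split.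
  by apply: eq_bigr => v _; rewrite !mxE -wE !mxE.
have ray : (x + t *: w) @[t --> (0 : R)] --> x.
  rewrite -[X in _ --> X]addr0 -(scale0r w).
  by apply: cvgD; [exact: cvg_cst|apply: cvgZr_tmp; exact: cvg_id].
have [t [t0 Pt]] : exists t : R, 0 < t /\ (H (x + t *: w) -> P (x + t *: w)).
  have : \forall t \near 0^'+, (H (x + t *: w) -> P (x + t *: w)).
    by apply: cvg_at_right_filter ray _ nearP.
  move=> near0; near (0 : R)^'+ => t; exists t; split; near: t => //.
  exact: nbhs_right_gt.
have /polytope_D_cut[_ /(_ S)] : P (x + t *: w).
  apply: Pt; have := sumw t [set: 'I_n]%SET; rewrite !inE subrr mulr0 addr0.
  under eq_bigl do rewrite inE; under [in RHS]eq_bigl do rewrite inE.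
  by rewrite /H /sum_zero_hyperplane /= => ->; exact: PH.
by rewrite sumw tight aS (negbTE bS) subr0 mulr1 gerDl leNgt t0.
Unshelve. all: by end_near.
Qed.

(** * Integral boundary points as net-degree sequences *)

Theorem proposition3p2 (R : realType) (n : nat) (hn : (1 <= n)%N)
    (d : 'rV[int]_n) :
  relative_boundary (sum_zero_hyperplane R n) (polytope_D R n)
    (map_mx (fun z : int => z%:~R : R) d) <->
  exists D : digraph 'I_n, weakly_split D /\ d = net_degree_sequence D.
Proof.
pose dR := map_mx (fun z : int => z%:~R : R) d.
have sumdR (S : {set 'I_n}) :
    \sum_(v in S) dR 0 v = (\sum_(v in S) d 0 v)%:~R.
  by rewrite rmorph_sum; apply: eq_bigr => v _; rewrite mxE.
have tightE (S : {set 'I_n}) :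
    \sum_(v in S) dR 0 v = (cut S)%:R <-> \sum_(v in S) d 0 v = (cut S)%:R.
  by rewrite sumdR pmulrn natz; split=> [/intr_inj|->].
have polyE : polytope_D R n dR <-> \sum_v d 0 v = 0 /\
    forall S : {set 'I_n}, \sum_(v in S) d 0 v <= (cut S)%:R.
  have sum0E : \sum_v dR 0 v = 0 <-> \sum_v d 0 v = 0.
    have -> : \sum_v dR 0 v = (\sum_v d 0 v)%:~R.
      by rewrite rmorph_sum; apply: eq_bigr => v _; rewrite mxE.
    by split=> [/eqP|->]; [rewrite intr_eq0 => /eqP|].
  have leE (S : {set 'I_n}) : (\sum_(v in S) dR 0 v <= (cut S)%:R) =
      (\sum_(v in S) d 0 v <= (cut S)%:R).
    by rewrite sumdR pmulrn natz ler_int.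
  by rewrite polytope_D_cut sum0E; split=> -[-> dS]; split=> // S;
    have := dS S; rewrite leE.
rewrite relative_boundary_polytope_D -/dR polyE.
(* Read over [int], the cut criterion yields an integral flow, where membership in the polytope only
   yields a real one. *)
rewrite -(flow_cutP _ _ (fun v => d 0 v)).
have netE (D : digraph 'I_n) (S : {set 'I_n}) : d = net_degree_sequence D ->
    \sum_(v in S) d 0 v = \sum_(v in S) net_degree D v.
  by move=> ->; apply: eq_bigr => v _; rewrite mxE.
split=> [[[s [s1 dE]] [S [S0 S1 tight]]]|
         [D [/weakly_splitP[S [S0 S1 tight]] dD]]].
  have [D DE] := int_flow_digraph _ s1; exists D.
  have dD : d = net_degree_sequence D.
    apply/rowP => v; rewrite mxE dE net_degree_flow.
    by apply: eq_bigr => e eE; rewrite DE.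
  split=> //; apply/weakly_splitP; exists S.
  by rewrite -netE //; split=> //; exact/tightE.
split; last by exists S; split=> //; apply/tightE; rewrite (netE D).
exists (flow_of D); split=> [e|v]; first exact: flow_of_bounds.
by rewrite dD mxE net_degree_flow.
Qed.
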